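(* Let $N_\lambda(t)$ and $N_\beta(t)$, $t\ge0$, be independent homogeneous Poisson processes of rates $\lambda>0$ and $\beta>0$ respectively, and let $\mathring N(t)=N_\lambda(t)-N_\beta(t)$. For every fixed $t>0$, $$\int_0^t\mathring N(s)\,\mathrm ds=\int_0^t N_\lambda(s)\,\mathrm ds-\int_0^t N_\beta(s)\,\mathrm ds\ \overset{\mathrm d}{=}\ \sum_{j=1}^{\widetilde N(t)}Z_j ,$$ where $\widetilde N(t)$, $t\ge0$, is a homogeneous Poisson process of rate $\lambda+\beta$, and $Z_1,Z_2,\dots$ are i.i.d. random variables, independent of $\widetilde N(t)$, with probability density $$f(s)=\begin{cases}\dfrac{\beta}{t(\lambda+\beta)}, & -t<s\le0,\\[2mm] \dfrac{\lambda}{t(\lambda+\beta)}, & 0<s<t,\end{cases}$$ and $f(s)=0$ otherwise. The sum is equal to zero when $\widetilde N(t)=0$.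
   Context: The symbol $\overset{\mathrm d}{=}$ denotes equality in distribution of the two random variables, for the fixed time $t$. *)

(* Defs.v *)
From HB Require Import structures.
From mathcomp Require Import all_boot all_order all_algebra.
From mathcomp Require Import finmap.
From mathcomp Require Import all_classical all_reals all_analysis.

Set Implicit Arguments.
Unset Strict Implicit.
Unset Printing Implicit Defensive.
Import Order.TTheory GRing.Theory Num.Theory.
Import numFieldNormedType.Exports.
Local Open Scope classical_set_scope.
Local Open Scope ring_scope.

(* The sigma-algebra sigma(X_i, i in D). *)
Definition sigma_family (d d' : measure_display) (T : measurableType d)
    (T' : measurableType d') (I : Type) (D : set I) (X : I -> T -> T') :
    set (set T) :=
  <<s \bigcup_(i in D) g_sigma_algebra_preimage (X i) >>.

Definition independent_systems (d : measure_display) (T : measurableType d)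
    (R : realType) (P : probability T R) (F G : set (set T)) : Prop :=
  forall A B, F A -> G B -> P (A `&` B) = (P A * P B)%E.

Definition mutually_independent (d d' : measure_display)
    (T : measurableType d) (T' : measurableType d') (R : realType)
    (P : probability T R) (I : choiceType) (X : I -> T -> T') : Prop :=
  forall (J : {fset I}) (A : I -> set T),
    (forall i, i \in J -> g_sigma_algebra_preimage (X i) (A i)) ->
    P (\bigcap_(i in [set` J]) A i) = (\prod_(i <- J) P (A i))%E.

(* The process is indexed by all reals; only the times t >= 0 are meaningful.
   The subtraction of naturals is not truncated, because paths are
   nondecreasing. Independence of the increments along every strictly increasing
   infinite sequence of times is the same as along every finite one, since
   independence of a family only involves its finite subfamilies.
   [poisson_pmf] is the Poisson mass function for positive parameters only,
   whence the field [poisson_rate_gt0]. *)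
Record poisson_process (d : measure_display) (T : measurableType d)
    (R : realType) (P : probability T R) (rate : R) (N : R -> T -> nat) : Prop :=
  PoissonProcess {
    poisson_rate_gt0 : 0 < rate ;
    poisson_measurable : forall t, 0 <= t -> measurable_fun setT (N t) ;
    poisson_start : forall w, N 0 w = 0%N ;
    poisson_nondecreasing : forall w s t, 0 <= s -> s <= t ->
      (N s w <= N t w)%N ;
    poisson_right_continuous : forall w t, 0 <= t ->
      ((N s w)%:R : R) @[s --> t^'+] --> ((N t w)%:R : R) ;
    poisson_independent_increments : forall tau : nat -> R,
      0 <= tau 0%N -> increasing_seq tau ->
      mutually_independent P
        (fun (i : nat) w => (N (tau i.+1) w - N (tau i) w)%N) ;
    poisson_increment_law : forall s t, 0 <= s -> s < t -> forall k : nat,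
      P [set w | (N t w - N s w)%N = k] =
      (poisson_pmf (rate * (t - s)) k)%:E
  }.

(* Independence of processes indexed by the nonnegative reals. *)
Definition independent_processes (d : measure_display) (T : measurableType d)
    (R : realType) (P : probability T R) (N M : R -> T -> nat) : Prop :=
  independent_systems P (sigma_family [set t : R | 0 <= t] N)
                        (sigma_family [set t : R | 0 <= t] M).

Definition has_density (d : measure_display) (T : measurableType d)
    (R : realType) (P : probability T R) (X : {RV P >-> R}) (f : R -> R) : Prop :=
  forall B : set R, measurable B ->
    distribution P X B = (\int[lebesgue_measure]_(x in B) (f x)%:E)%E.

(* The two variables may live on different probability spaces. Their
   measurability is part of the claim, so that neither law is evaluated on a
   non-measurable preimage. *)
Definition eq_in_distribution (d d' : measure_display) (T : measurableType d)
    (T' : measurableType d') (R : realType) (P : probability T R)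
    (Q : probability T' R) (X : T -> R) (Y : T' -> R) : Prop :=
  [/\ measurable_fun setT X, measurable_fun setT Y &
      forall B : set R, measurable B -> P (X @^-1` B) = Q (Y @^-1` B)].

Definition jump_density (R : realType) (lambda beta t : R) (s : R) : R :=
  if (- t < s) && (s <= 0) then beta / (t * (lambda + beta))
  else if (0 < s) && (s < t) then lambda / (t * (lambda + beta))
  else 0.

(* Main.v *)
Require Import Defs.
From HB Require Import structures.
From mathcomp Require Import all_boot all_order all_algebra.
From mathcomp Require Import finmap.
From mathcomp Require Import all_classical all_reals all_analysis.
From mathcomp Require Import measurable_realfun.
From mathcomp Require Import zify ring lra.

Set Implicit Arguments.
Unset Strict Implicit.
Unset Printing Implicit Defensive.
Import Order.TTheory GRing.Theory Num.Theory.
Import numFieldNormedType.Exports.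
Local Open Scope classical_set_scope.
Local Open Scope ring_scope.

(** The idea is to discretize both variables on the same grid, where the
identity becomes Poisson thinning, and then to refine the grid.

Cut [0, t] into m = n+1 intervals of length h = t / m. An integral of a path
is the sum, over its jumps, of the time left after the jump. So, up to an error
of at most h per jump, the integral of the difference is the sum over i of
[h (n - i)] times the i-th increment of the first process minus the sum over i
of [h (m - i)] times the i-th increment of the second one. These are the lower
Riemann sum of the positive part and the upper Riemann sum of the negative part
([riemann_lower], [riemann_upper], [riemann_gap]), so the discretized integral
is at most the integral. The increments are 2m independent Poisson variables
([probability_jump_counts]).

On the other side, each Z is rounded down to a multiple of h. The rounded variable
takes the value h (n - i) with probability lambda / ((lambda + beta) m) and
- h (m - i) with probability beta / ((lambda + beta) m), that is, exactly the
weights above. By thinning ([probability_thinned_event]) the numbers of jumps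
of the random sum falling in the 2m cells are independent Poisson variables with
the same parameters as the increments. Hence the two discretized variables have
the same law ([eq_in_distribution_discretization]).

Finally both discretizations lie below the true variables, with an error O(1/m)
at each sample point. Therefore the event that the limit exceeds a is the lim inf
of the events that the approximations exceed a; the probabilities of the rays
]a, +oo[ agree in the limit, and the rays determine the law
([eq_in_distribution_lim]). *)

(** * Limits in distribution from one-sided approximation *)

(** Continuity from below applied to the intersections of the tails of F. A
supremum is used rather than a limit, so that two sequences of events with equal
probabilities give equal values without any discussion of convergence. *)
Lemma measure_liminf_sup (d : measure_display) (T : measurableType d)
    (R : realType) (P : probability T R) (A : set T) (F : (set T)^nat) :
  measurable A -> (forall n, measurable (F n)) ->
  (forall n, F n `<=` A) ->
  (forall w, A w -> exists N, forall n, (N <= n)%N -> F n w) ->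
  P A = ereal_sup (range (fun n => P (F n))).
Proof.
move=> mA mF FA AF; apply/eqP; rewrite eq_le; apply/andP; split; last first.
  by apply: ge_ereal_sup => _ [n _ <-]; apply: le_measure; rewrite ?inE.
pose G n := \bigcap_(k in [set k | (n <= k)%N]) F k.
have mG n : measurable (G n) by apply: bigcap_measurable => //; exists n => /=.
have GE : \bigcup_n G n = A.
  apply/seteqP; split => [w [n _ Gw]|w /AF[N Nw]].
    by apply: (FA n); apply: Gw => /=.
  by exists N => // k /= /Nw.
have cG : (P \o G) n @[n --> \oo] --> P A.
  rewrite -GE; apply: nondecreasing_cvg_mu => //.
    by rewrite GE.
  by move=> n m nm; apply/subsetPset => w Gw k /= mk; apply: Gw => /=;
    exact: leq_trans mk.
rewrite -(cvg_lim _ cG)//; apply: lime_le; first exact: (cvgP _ cG).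
apply: nearW => n; apply: (@le_trans _ _ (P (F n))).
  by apply: le_measure; rewrite ?inE// => w; apply => /=.
by apply: ereal_sup_ubound; exists n.
Qed.

Lemma cvg_of_bound_over_n (R : realType) (x K : R) (u : nat -> R) :
  (forall n, u n <= x <= u n + K / n.+1%:R) -> u n @[n --> \oo] --> x.
Proof.
move=> ux.
have lx : x - K / n.+1%:R @[n --> \oo] --> x.
  rewrite -[X in _ --> X]subr0; apply: cvgB; first exact: cvg_cst.
  rewrite -[X in _ --> X](mulr0 K); apply: cvgM; first exact: cvg_cst.
  exact: cvg_harmonic.
apply: (@squeeze_cvgr _ _ _ _ (fun n => x - K / n.+1%:R) (fun=> x)) => //;
  last exact: cvg_cst.
by apply: nearW => n; have /andP[a b] := ux n; rewrite a andbT lerBlDr.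
Qed.

(** Under approximation from below the indicators of the rays ]a, +oo[ converge at
every sample point, even where X = a: once X exceeds a, so do all late
approximations, and an approximation that exceeds a forces X to. Atoms of the
limit law therefore cause no trouble. The bounds K and K' may depend on the
sample point. *)
Lemma eq_in_distribution_lim (d d' : measure_display) (T : measurableType d)
    (T' : measurableType d') (R : realType) (P : probability T R)
    (Q : probability T' R) (X K : T -> R) (Y K' : T' -> R)
    (X_ : nat -> T -> R) (Y_ : nat -> T' -> R) :
  (forall n w, X_ n w <= X w <= X_ n w + K w / n.+1%:R) ->
  (forall n w, Y_ n w <= Y w <= Y_ n w + K' w / n.+1%:R) ->
  (forall n, eq_in_distribution P Q (X_ n) (Y_ n)) ->
  eq_in_distribution P Q X Y.
Proof.
move=> hX hY hXY.
have mX_ n : measurable_fun setT (X_ n) by case: (hXY n).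
have mY_ n : measurable_fun setT (Y_ n) by case: (hXY n).
have mX : measurable_fun setT X.
  apply: (measurable_fun_cvg mX_) => w _.
  by apply: (@cvg_of_bound_over_n _ _ (K w)) => n; exact: hX.
have mY : measurable_fun setT Y.
  apply: (measurable_fun_cvg mY_) => w _.
  by apply: (@cvg_of_bound_over_n _ _ (K' w)) => n; exact: hY.
(* The probability of a ray under the limit only depends on those under the
   approximations. *)
have ray (e : measure_display) (S : measurableType e) (M : probability S R)
    (U V : S -> R) (U_ : nat -> S -> R) a :
    measurable_fun setT U -> (forall n, measurable_fun setT (U_ n)) ->
    (forall n w, U_ n w <= U w <= U_ n w + V w / n.+1%:R) ->
    M (U @^-1` `]a, +oo[) = ereal_sup (range (fun n => M (U_ n @^-1` `]a, +oo[))).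
  move=> mU mU_ hU; apply: measure_liminf_sup.
  - by rewrite -[X in measurable X]setTI; exact: mU.
  - by move=> n; rewrite -[X in measurable X]setTI; exact: mU_.
  - move=> n w /=; rewrite !in_itv/= !andbT => /lt_le_trans; apply.
    by have /andP[] := hU n w.
  - move=> w /=; rewrite in_itv/= andbT => aw.
    have cU : U_ n w @[n --> \oo] --> U w.
      by apply: (@cvg_of_bound_over_n _ _ (V w)) => n; exact: hU.
    have : \forall n \near \oo, a < U_ n w by exact: (cvgr_gt _ cU).
    by case=> N _ hN; exists N => n Nn; rewrite /= in_itv/= andbT; exact: hN.
split => // B mB.
rewrite -[LHS]/(pushforward P X B) -[RHS]/(pushforward Q Y B).
pose m1 : {measure set R -> \bar R} :=
  distribution P (mfun_Sub (mem_set mX : X \in mfun)).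
pose m2 : {measure set R -> \bar R} :=
  distribution Q (mfun_Sub (mem_set mY : Y \in mfun)).
rewrite -[LHS]/(m1 B) -[RHS]/(m2 B).
(* The rays form a pi-system that generates the Borel sets. *)
have U := @measure_unique _ R _ (@RGenOInfty.G R)
  (fun n => `](- n%:R), +oo[%classic) _ _ _ _ m1 m2 _ _ B mB; apply: U => //.
- exact: RGenOInfty.measurableE.
- move=> _ _ [x ->] [y ->]; exists (Num.max x y).
  by apply/seteqP; split => z /=; rewrite !in_itv/= !andbT gt_max;
    [case=> -> ->|case/andP].
- by move=> n; exists (- n%:R).
- apply/seteqP; split => // x _; exists (Num.bound `|x|) => //=.
  rewrite in_itv/= andbT ltrNl (le_lt_trans (ler_norm _))// normrN.
  exact: archi_boundP.
- move=> _ [a ->]; rewrite /m1 /m2 /= /distribution /pushforward /=.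
  rewrite (ray _ _ _ _ K X_)// (ray _ _ _ _ K' Y_)//.
  by congr ereal_sup; apply: eq_imagel => n _; case: (hXY n) => _ _; apply.
- by move=> n; rewrite (le_lt_trans (probability_le1 _ _))// ?ltry.
Qed.

(** * Laws of functions of a countable-valued variable *)

Lemma measurable_countable_bigcup (d : measure_display) (T : measurableType d)
    (C : countType) (F : C -> set T) (S : set C) :
  (forall c, measurable (F c)) -> measurable (\bigcup_(c in S) F c).
Proof.
move=> mF; rewrite bigcup_mkcond; apply: countable_bigcupT_measurable.
  exact: countableP.
by move=> c; case: ifP.
Qed.

Lemma probability_countable_bigcup (d d' : measure_display)
    (T : measurableType d) (T' : measurableType d') (R : realType)
    (P : probability T R) (Q : probability T' R) (C : countType)
    (E : C -> set T) (F : C -> set T') (S : set C) :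
  (forall c, measurable (E c)) -> (forall c, measurable (F c)) ->
  trivIset setT E -> trivIset setT F -> (forall c, P (E c) = Q (F c)) ->
  P (\bigcup_(c in S) E c) = Q (\bigcup_(c in S) F c).
Proof.
move=> mE mF tE tF PQ.
pose D : set nat := [set n | exists2 c, S c & n = choice.pickle c].
pose ext U (G : C -> set U) n := oapp G set0 (pickle_inv n).
have bigcup_ext U (G : C -> set U) :
    \bigcup_(c in S) G c = \bigcup_(n in D) ext U G n.
  apply/seteqP; split=> [x [c Sc Gx]|x [_ [c Sc ->] Gx]].
    by exists (choice.pickle c); [exists c|rewrite /ext pickleK_inv].
  by exists c => //; move: Gx; rewrite /ext pickleK_inv.
have triv_ext U (G : C -> set U) : trivIset setT G -> trivIset D (ext U G).
  move=> tG _ _ [a _ ->] [b _ ->]; rewrite /ext !pickleK_inv /= => ab.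
  by congr choice.pickle; exact: tG.
have ext_m (e : measure_display) (U : measurableType e) (G : C -> set U) n :
    (forall c, measurable (G c)) -> measurable (ext U G n).
  by move=> mG; rewrite /ext; case: (pickle_inv n) => [c|] /=.
rewrite !bigcup_ext !measure_bigcup//; try exact: triv_ext; try by move=> *; exact: ext_m.
apply: eq_eseriesr => n _; rewrite /ext.
by case: (pickle_inv n) => [c|] /=; rewrite ?measure0.
Qed.

(** The events F c need not cover T': a null set may be left out, on which Y is
arbitrary. Their probabilities add up to 1 because those of the atoms of V do;
this is why the inequality [le] below, applied to B and to its complement,
suffices. *)
Lemma eq_in_distribution_atoms (d d' : measure_display)
    (T : measurableType d) (T' : measurableType d') (R : realType)
    (P : probability T R) (Q : probability T' R) (C : countType)
    (V : T -> C) (F : C -> set T') (phi : C -> R) (X : T -> R) (Y : T' -> R) :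
  (forall c, measurable (V @^-1` [set c])) -> (forall c, measurable (F c)) ->
  trivIset setT F -> (forall c, P (V @^-1` [set c]) = Q (F c)) ->
  (forall w, X w = phi (V w)) -> (forall c w, F c w -> Y w = phi c) ->
  measurable_fun setT Y -> eq_in_distribution P Q X Y.
Proof.
move=> mV mF tF PQ XV YF mY.
have XE (B : set R) : X @^-1` B = \bigcup_(c in phi @^-1` B) V @^-1` [set c].
  apply/seteqP; split=> [w /= Bw|w [c /= Bc Vw]].
    by exists (V w) => //=; rewrite -XV.
  by rewrite XV Vw.
have mX : measurable_fun setT X.
  move=> _ B _; rewrite setTI XE.
  exact: measurable_countable_bigcup.
split=> // B mB.
have mYB A : measurable A -> measurable (Y @^-1` A).
  by move=> mA; rewrite -[X in measurable X]setTI; exact: mY.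
have mXB A : measurable A -> measurable (X @^-1` A).
  by move=> mA; rewrite -[X in measurable X]setTI; exact: mX.
have le A : measurable A -> (P (X @^-1` A) <= Q (Y @^-1` A))%E.
  move=> mA; rewrite XE (@probability_countable_bigcup _ _ _ _ _ P Q _ _ F)//.
    apply: le_measure; rewrite ?inE//; first exact: measurable_countable_bigcup.
      exact: mYB.
    by move=> w [c /= Bc Fw]; rewrite (YF c).
  by move=> a b _ _ [w [/= <- <-]].
apply/eqP; rewrite eq_le le//=.
(* The reverse inequality is the same one for the complement of B. *)
have := le _ (measurableC mB).
rewrite -!preimage_setC.
rewrite (probability_setC P (mXB _ mB)) (probability_setC Q (mYB _ mB)).
have fP : P (X @^-1` B) \is a fin_num by apply: fin_num_measure; exact: mXB.
have fQ : Q (Y @^-1` B) \is a fin_num by apply: fin_num_measure; exact: mYB.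
rewrite -(fineK fP) -(fineK fQ) -!EFinB !lee_fin.
by rewrite lerD2l lerN2.
Qed.

Lemma measurable_random_sum (d : measure_display) (T : measurableType d)
    (R : realType) (N : T -> nat) (Z : nat -> T -> R) :
  measurable_fun setT N -> (forall j, measurable_fun setT (Z j)) ->
  measurable_fun setT (fun w => \sum_(j < N w) Z j w).
Proof.
move=> mN mZ _ B mB; rewrite setTI.
have -> : (fun w => \sum_(j < N w) Z j w) @^-1` B =
    \bigcup_(k in [set: nat]) ((N @^-1` [set k]) `&`
      (fun w => \sum_(j < k) Z j w) @^-1` B).
  by apply/seteqP; split=> [w Bw|w [k _ [/= <- Bw]]] //; exists (N w).
apply: measurable_countable_bigcup => k; apply: measurableI.
  by rewrite -[X in measurable X]setTI; exact: mN.
rewrite -[X in measurable X]setTI.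
have := @measurable_sum _ _ R setT _ (index_enum 'I_k) (fun j : 'I_k => Z j).
by apply.
Qed.

(** * The multinomial sum over words *)

Definition content (I : finType) (s : seq I) : {ffun I -> nat} :=
  [ffun i => count_mem i s].

(** Truncated at 0; only used where v is positive at i. *)
Definition ffun_pred_at (I : finType) (i : I) (v : {ffun I -> nat}) :
    {ffun I -> nat} := [ffun j => (v j - (j == i))%N].

Lemma content_cons (I : finType) (x : I) (s : seq I) (v : {ffun I -> nat}) :
  (content (x :: s) == v) = (0 < v x)%N && (content s == ffun_pred_at x v).
Proof.
apply/eqP/andP => [<-|[vx /eqP/ffunP sv]].
  rewrite ffunE /= eqxx; split=> //; apply/eqP/ffunP => j; rewrite !ffunE /=.
  by rewrite eq_sym addKn.
apply/ffunP => j; have := sv j; rewrite !ffunE /= => ->.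
by rewrite eq_sym; case: (eqVneq j x) => [->|_]; rewrite ?subn0// subnKC.
Qed.

Lemma sum_ffun_pred_at (I : finType) (x : I) (v : {ffun I -> nat}) :
  (0 < v x)%N -> (\sum_i v i)%N = (\sum_i ffun_pred_at x v i).+1.
Proof.
move=> vx; rewrite (bigD1 x)//= [in RHS](bigD1 x)//= ffunE eqxx subn1.
rewrite -addSn prednK//; congr addn; apply: eq_bigr => j /negPf jx.
by rewrite ffunE jx subn0.
Qed.

Lemma big_tuple_cons (R : Type) (idx : R) (op : Monoid.com_law idx)
    (I : finType) (k : nat) (Q : pred (seq I)) (F : seq I -> R) :
  \big[op/idx]_(s : k.+1.-tuple I | Q s) F s =
  \big[op/idx]_i \big[op/idx]_(s : k.-tuple I | Q (i :: s)) F (i :: s).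
Proof.
rewrite pair_big_dep /=.
rewrite (reindex (fun p : I * k.-tuple I => [tuple of p.1 :: p.2]))//=.
exists (fun s : k.+1.-tuple I => (thead s, [tuple of behead s])) => [[i s] _|s _] /=.
  by congr pair; apply: val_inj.
by rewrite -tuple_eta.
Qed.

(** Induction on the length: removing the first letter i of a word of content v
leaves a word whose content is v minus one i. The sum over these shorter words,
times [q i], is [v i] times [k`! * \prod_j (q j ^+ v j / (v j)`!)], and the
factors [v i] add up to k+1. *)
Lemma multinomial_tuple_sum (R : numFieldType) (I : finType) (q : I -> R)
    (k : nat) (v : {ffun I -> nat}) :
  \sum_(s : k.-tuple I | content s == v) \prod_(i <- s) q i =
  if (\sum_i v i == k)%N
  then k`!%:R * \prod_i (q i ^+ v i / (v i)`!%:R) else 0.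
Proof.
elim: k v => [|k IHk] v.
  rewrite (eq_bigl (fun s : 0.-tuple I =>
    (s == [tuple]) && (content [::] == v))); last first.
    move=> s; have -> : s == [tuple] by apply/eqP; exact: tuple0.
    by rewrite (tuple0 s).
  rewrite sum_nat_eq0.
  have -> : (content [::] == v) = [forall i, v i == 0%N].
    apply/eqP/forallP => [<- i|v0]; first by rewrite ffunE.
    by apply/ffunP => i; rewrite ffunE (eqP (v0 i)).
  case: ifPn => [/forallP v0|_]; last by rewrite big_pred0// => s; rewrite andbF.
  rewrite (big_pred1 [tuple]) => [|s]; last by rewrite andbT.
  rewrite /= big_nil fact0 mul1r big1// => i _.
  by rewrite (eqP (v0 i)) expr0 fact0 divr1.
rewrite (big_tuple_cons _ _ (fun s => content s == v) (fun s => \prod_(i <- s) q i)).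
transitivity (\sum_i if (\sum_j v j == k.+1)%N then
    (v i)%:R * (k`!%:R * \prod_j (q j ^+ v j / (v j)`!%:R)) else 0); last first.
  case: ifP => [/eqP vk|_]; last by rewrite big1.
  by rewrite -mulr_suml -natr_sum vk mulrA -natrM -factS.
apply: eq_bigr => i _.
rewrite (eq_bigl _ _ (fun s : k.-tuple I => content_cons i s v)).
have [vi0|vi_gt0] := posnP (v i).
  rewrite big_pred0; last by move=> s.
  by rewrite vi0 mul0r if_same.
under eq_bigr do rewrite big_cons.
rewrite -big_distrr /= IHk (sum_ffun_pred_at vi_gt0) eqSS.
case: ifP => _; last by rewrite mulr0.
rewrite mulrCA [RHS]mulrCA; congr (_ * _).
rewrite (bigD1 i)//= [in RHS](bigD1 i)//= !mulrA; congr (_ * _); last first.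
  by apply: eq_bigr => j /negPf ji; rewrite ffunE ji subn0.
rewrite ffunE eqxx subn1; case: (v i) vi_gt0 => // m _ /=.
rewrite exprS factS natrM; field.
by rewrite nat1r !pnatr_eq0 -lt0n fact_gt0.
Qed.

(** * Poisson thinning *)

(** The factorials of the total cancel, its power of rate is shared among the
classes, and the exponential factorizes since the p i add up to 1. *)
Lemma poisson_pmf_thinning (R : realType) (I : finType) (rate : R)
    (p : I -> R) (v : {ffun I -> nat}) :
  0 < rate -> (forall i, 0 < p i) -> \sum_i p i = 1 ->
  poisson_pmf rate (\sum_i v i) *
    ((\sum_i v i)`!%:R * \prod_i (p i ^+ v i / (v i)`!%:R)) =
  \prod_i poisson_pmf (rate * p i) (v i).
Proof.
move=> rate0 p0 p1; rewrite /poisson_pmf rate0.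
under [RHS]eq_bigr do rewrite mulr_gt0//.
rewrite [RHS]big_split/= -expR_sum sumrN -mulr_sumr p1 mulr1.
transitivity (expR (- rate) * (rate ^+ (\sum_i v i) * \prod_i (p i ^+ v i / (v i)`!%:R))).
  by field; rewrite pnatr_eq0 -lt0n fact_gt0.
rewrite mulrC; congr (_ * _); rewrite -prodrXr -big_split/=.
by apply: eq_bigr => i _; rewrite exprMn mulrA.
Qed.

(** Membership in [sigma_family] is measurability for the generated sigma-algebra,
so closure properties can be taken from the theory of measurable functions. *)
Lemma measurable_sigma_family (d d' : measure_display) (T : measurableType d)
    (T' : measurableType d') (I : Type) (D : set I) (X : I -> T -> T') (i : I) :
  D i ->
  measurable_fun [set: g_sigma_algebraType
    (\bigcup_(i in D) g_sigma_algebra_preimage (X i))] (X i).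
Proof.
move=> Di _ B mB; rewrite setTI; apply: sub_sigma_algebra.
by exists i => //; exists B => //; rewrite setTI.
Qed.

Lemma mutually_independent_prefix (d d' : measure_display)
    (T : measurableType d) (T' : measurableType d') (R : realType)
    (P : probability T R) (X : nat -> T -> T') (n : nat) (B : nat -> set T') :
  mutually_independent P X -> (forall i, measurable (B i)) ->
  P (\bigcap_(i in `I_n) X i @^-1` B i) = (\prod_(i < n) P (X i @^-1` B i))%E.
Proof.
move=> indX mB.
have := indX [fset i in iota 0 n]%fset (fun i => X i @^-1` B i).
have -> : [set` [fset i in iota 0 n]%fset] = `I_n.
  by apply/seteqP; split=> i /=; rewrite in_fset /= mem_iota add0n.
move=> ->; last by move=> i _; exists (B i) => //; rewrite setTI.
rewrite -(big_mkord xpredT (fun i => P (X i @^-1` B i))) /index_iota subn0.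
apply: perm_big; apply: uniq_perm; rewrite ?iota_uniq ?fset_uniq//.
by move=> i; rewrite in_fset.
Qed.

Lemma measure_fin_pred_bigcup (d : measure_display) (T : measurableType d)
    (R : realType) (P : probability T R) (I : finType) (Q : pred I)
    (F : I -> set T) :
  (forall i, measurable (F i)) -> trivIset setT F ->
  P (\bigcup_(i in [set i | Q i]) F i) = (\sum_(i | Q i) P (F i))%E.
Proof.
move=> mF tF.
have -> : [set i | Q i] = [set` enum Q].
  by apply/seteqP; split=> i /=; rewrite mem_enum.
rewrite measure_fin_bigcup//; last exact: sub_trivIset tF.
by rewrite -fsbig_seq ?enum_uniq// big_enum.
Qed.

Section thinning.
Context (d : measure_display) (T : measurableType d) (R : realType).
Context (P : probability T R) (N : T -> nat) (Z : nat -> {RV P >-> R}).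
Hypothesis mN : measurable_fun setT N.
Hypothesis Z_indep : mutually_independent P (fun j w => Z j w).
Hypothesis ZN_indep : independent_systems P
  (sigma_family setT (fun j w => Z j w)) (g_sigma_algebra_preimage N).
Context (I : finType) (i0 : I) (D : I -> set R) (p : I -> R) (rate : R).
Hypothesis mD : forall i, measurable (D i).
Hypothesis tD : trivIset setT D.
Hypothesis ZD : forall j i, P (Z j @^-1` D i) = (p i)%:E.
Hypothesis N_law : forall k, P (N @^-1` [set k]) = (poisson_pmf rate k)%:E.
Hypothesis rate_gt0 : 0 < rate.
Hypothesis p_gt0 : forall i, 0 < p i.
Hypothesis p_sum1 : \sum_i p i = 1.

(** The first [size s] variables fall in the cells spelled by the word s; i0 is only
the default value of [nth]. *)
Definition word_event (s : seq I) : set T :=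
  \bigcap_(j in `I_(size s)) Z j @^-1` D (nth i0 s j).

Definition content_event (v : {ffun I -> nat}) : set T :=
  \bigcup_(s in [set s : (\sum_i v i).-tuple I | content s == v]) word_event s.

(** There are as many terms as v counts, and v i of them fall in the cell i. Samples
with a term outside all cells belong to none of these events. *)
Definition thinned_event (v : {ffun I -> nat}) : set T :=
  content_event v `&` N @^-1` [set (\sum_i v i)%N].

Lemma sigma_family_word_event s :
  sigma_family setT (fun j w => Z j w) (word_event s).
Proof.
set G := \bigcup_(i in setT) g_sigma_algebra_preimage (fun w => Z i w).
apply: (@bigcap_measurableType _ (g_sigma_algebraType G)) => i _.
rewrite -[X in measurable X]setTI.
by apply: (@measurable_sigma_family _ _ _ _ _ setT (fun j w => Z j w) i).
Qed.

Lemma measurable_word_event s : measurable (word_event s).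
Proof.
apply: bigcap_measurableType => i _.
exact: measurable_funPTI.
Qed.

Lemma probability_word_event s :
  P (word_event s) = (\prod_(i <- s) p i)%:E.
Proof.
rewrite /word_event (mutually_independent_prefix (size s)
  (B := fun j => D (nth i0 s j)) Z_indep)//.
rewrite (big_nth i0) big_mkord -prodEFin.
by apply: eq_bigr => j _; exact: ZD.
Qed.

Lemma word_event_inj s s' w :
  size s = size s' -> word_event s w -> word_event s' w -> s = s'.
Proof.
move=> ss' sw s'w; apply: (@eq_from_nth _ i0) => // j js.
apply: tD => //.
exists (Z j w); split; first exact: sw.
by apply: s'w => /=; rewrite -ss'.
Qed.

Lemma sigma_family_content_event v :
  sigma_family setT (fun j w => Z j w) (content_event v).
Proof.
set G := \bigcup_(i in setT) g_sigma_algebra_preimage (fun w => Z i w).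
apply: (@measurable_countable_bigcup _ (g_sigma_algebraType G)) => s.
exact: sigma_family_word_event.
Qed.

Lemma measurable_thinned_event v : measurable (thinned_event v).
Proof.
apply: measurableI; last by rewrite -[X in measurable X]setTI; exact: mN.
by apply: measurable_countable_bigcup => s; exact: measurable_word_event.
Qed.

Lemma trivIset_thinned_event : trivIset setT thinned_event.
Proof.
move=> v v' _ _ [w [[[s /eqP sv sw] Nv] [[s' /eqP sv' sw'] Nv']]].
rewrite -sv -sv'; congr content; apply: word_event_inj sw sw'.
by rewrite !size_tuple -Nv -Nv'.
Qed.

(** Given the number of terms, the probability of a content is that of its words
times their number, which is the multinomial sum; the Poisson law of the number
of terms then splits it into a product of Poisson laws. *)
Lemma probability_thinned_event v :
  P (thinned_event v) = (\prod_i poisson_pmf (rate * p i) (v i))%:E.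
Proof.
rewrite /thinned_event ZN_indep; [|exact: sigma_family_content_event|]; last first.
  by exists [set (\sum_i v i)%N] => //; rewrite setTI.
rewrite N_law /content_event measure_fin_pred_bigcup; last 2 first.
  by move=> s; exact: measurable_word_event.
  move=> s s' _ _ [w [sw s'w]]; apply/val_inj; apply: word_event_inj sw s'w.
  by rewrite !size_tuple.
rewrite (eq_bigr (fun s : (\sum_i v i).-tuple I => (\prod_(i <- s) p i)%:E)); last first.
  by move=> s _; exact: probability_word_event.
rewrite sumEFin multinomial_tuple_sum eqxx -EFinM; congr EFin.
by rewrite mulrC poisson_pmf_thinning.
Qed.

Lemma thinned_event_sum v w (g : R -> R) (x : I -> R) :
  (forall i z, D i z -> g z = x i) -> thinned_event v w ->
  \sum_(j < N w) g (Z j w) = \sum_i x i *+ v i.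
Proof.
move=> gx [[s /= /eqP sv sw] /= Nv].
transitivity (\sum_(j < size s) g (Z j w)); first by rewrite Nv size_tuple.
move: (val s) sv sw => {Nv s} s sv sw.
transitivity (\sum_(i <- s) x i).
  rewrite (big_nth i0) big_mkord; apply: eq_bigr => j _.
  by apply: gx; apply: sw; exact: ltn_ord.
rewrite -sv; under [RHS]eq_bigr do rewrite ffunE.
elim: s {sv sw} => [|y r IHr]; first by rewrite big_nil big1.
rewrite big_cons IHr /=; under [RHS]eq_bigr do rewrite mulrnDr.
rewrite big_split/= [in RHS](bigD1 y)//= eqxx.
rewrite [X in _ = _ + X + _]big1 ?addr0// => i /negPf.
by rewrite eq_sym => ->.
Qed.

End thinning.

(** * Increments of Poisson processes along a grid *)

Section increments.
Context (d : measure_display) (T : measurableType d) (R : realType).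
Context (P : probability T R) (rate : R) (N : R -> T -> nat).
Hypothesis NP : poisson_process P rate N.
Context (h : R).
Hypothesis h_gt0 : 0 < h.

Definition increment (i : nat) (w : T) : nat :=
  (N (h * i.+1%:R) w - N (h * i%:R) w)%N.

Lemma grid_ge0 i : 0 <= h * i%:R.
Proof. by rewrite mulr_ge0 ?ler0n// ltW. Qed.

Lemma sigma_family_increments m (v : nat -> nat) :
  sigma_family [set t : R | 0 <= t] N
    (\bigcap_(i in `I_m) increment i @^-1` [set v i]).
Proof.
set G := \bigcup_(i in [set t : R | 0 <= t]) g_sigma_algebra_preimage (N i).
have mI i : measurable_fun [set: g_sigma_algebraType G] (increment i).
  by apply: measurable_fun_subn; apply: measurable_sigma_family; exact: grid_ge0.
apply: (@bigcap_measurableType _ (g_sigma_algebraType G)) => i _.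
by rewrite -[X in measurable X]setTI; exact: mI.
Qed.

Lemma probability_increments m (v : nat -> nat) :
  P (\bigcap_(i in `I_m) increment i @^-1` [set v i]) =
  (\prod_(i < m) poisson_pmf (rate * h) (v i))%:E.
Proof.
rewrite (mutually_independent_prefix m (X := increment))//; last first.
  apply: (poisson_independent_increments NP (tau := fun i => h * i%:R)).
    exact: grid_ge0.
  by move=> i j; rewrite ler_pM2l// ler_nat.
rewrite -prodEFin; apply: eq_bigr => i _.
rewrite [LHS](poisson_increment_law NP) ?grid_ge0//; last first.
  by rewrite ltr_pM2l// ltr_nat.
by rewrite -mulrBr -natrB// subSnn mulr1.
Qed.

End increments.

Section jump_counts.
Context (d : measure_display) (T : measurableType d) (R : realType).
Context (P : probability T R) (lambda beta : R) (Nl Nb : R -> T -> nat).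
Hypothesis NlP : poisson_process P lambda Nl.
Hypothesis NbP : poisson_process P beta Nb.
Hypothesis Nlb_indep : independent_processes P Nl Nb.
Context (h : R) (n : nat).
Hypothesis h_gt0 : 0 < h.

(** The Boolean tells the first process from the second one. *)
Definition jump_counts (w : T) : {ffun bool * 'I_n.+1 -> nat} :=
  [ffun p : bool * 'I_n.+1 => increment (if p.1 then Nl else Nb) h p.2 w].

Lemma preimage_jump_counts v : jump_counts @^-1` [set v] =
  (\bigcap_(i in `I_n.+1) increment Nl h i @^-1` [set v (true, inord i)]) `&`
  (\bigcap_(i in `I_n.+1) increment Nb h i @^-1` [set v (false, inord i)]).
Proof.
apply/seteqP; split=> [w <-|w [lw bw]].
  by split=> i /= im; rewrite ffunE /= inordK.
apply/ffunP => -[[] i]; rewrite ffunE /=.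
  by rewrite lw//= inord_val.
by rewrite bw//= inord_val.
Qed.

Lemma measurable_preimage_jump_counts v : measurable (jump_counts @^-1` [set v]).
Proof.
have mI M rate i k : poisson_process P rate M ->
    measurable (increment M h i @^-1` [set k]).
  move=> MP; rewrite -[X in measurable X]setTI.
  by apply: measurable_fun_subn => //; apply: (poisson_measurable MP); exact: grid_ge0.
rewrite preimage_jump_counts.
by apply: measurableI; apply: bigcap_measurableType => i _; [exact: mI NlP|exact: mI NbP].
Qed.

(** Independence of the two processes separates the two families of increments, and
independence of increments separates the times. *)
Lemma probability_jump_counts v : P (jump_counts @^-1` [set v]) =
  (\prod_p poisson_pmf ((if p.1 then lambda else beta) * h) (v p))%:E.
Proof.
rewrite preimage_jump_counts Nlb_indep; try by apply: sigma_family_increments.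
rewrite (probability_increments NlP h_gt0 _ (fun i => v (true, inord i))).
rewrite (probability_increments NbP h_gt0 _ (fun i => v (false, inord i))).
rewrite -EFinM; congr EFin.
rewrite [RHS](eq_bigr (fun p =>
  poisson_pmf ((if p.1 then lambda else beta) * h) (v (p.1, p.2)))); last by case.
rewrite -(pair_bigA _ (fun b i =>
  poisson_pmf ((if b then lambda else beta) * h) (v (b, i)))) /=.
rewrite big_bool /=.
by congr (_ * _); apply: eq_bigr => i _; rewrite inord_val.
Qed.

End jump_counts.

(** * Riemann sums of nondecreasing functions *)

Section riemann.
Context (R : realType).
Local Notation mu := (@lebesgue_measure R).

Lemma integral_step (b : bool) (t u a : R) : 0 <= u <= t ->
  let f := fun x => a * \1_([set` Interval (BSide b u) (BRight t)]) x in
  mu.-integrable `[0, t] (EFin \o f) /\ \int[mu]_(x in `[0, t]) f x = a * (t - u).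
Proof.
move=> /andP[u0 ut] f.
have mA : measurable [set` Interval (BSide b u) (BRight t)] by exact: measurable_itv.
have i1 : mu.-integrable `[0, t]
    (EFin \o (\1_([set` Interval (BSide b u) (BRight t)]) : R -> R)).
  by apply: (integrableS _ _ _ (integrable_indic_itv u t b false)).
split.
  exact: (@integrableZl _ _ _ mu _ _ a _ i1).
rewrite RintegralZl//; congr (_ * _).
rewrite /Rintegral integral_indic//=.
rewrite setIidl; last first.
  move=> x /=; rewrite !in_itv /= => /andP[ux ->]; rewrite andbT.
  by case: b ux {mA i1 f} => /=; [|move/ltW]; exact: le_trans.
rewrite lebesgue_measure_itv/= lte_fin.
have [_|tu] := ltP u t; first by [].
by rewrite (@le_anti _ _ u t) ?subrr// ut.
Qed.

(** The function with jump a i at u i; b tells whether the jump is already counted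
at time u i itself. *)
Definition step_fun (b : bool) (t : R) (u a : nat -> R) (m : nat) (x : R) : R :=
  \sum_(i < m) a i * \1_([set` Interval (BSide b (u i)) (BRight t)]) x.

Lemma integral_step_fun (b : bool) (t : R) (u a : nat -> R) (m : nat) :
  (forall i, (i < m)%N -> 0 <= u i <= t) ->
  mu.-integrable `[0, t] (EFin \o step_fun b t u a m) /\
  \int[mu]_(x in `[0, t]) step_fun b t u a m x = \sum_(i < m) a i * (t - u i).
Proof.
elim: m => [|m IHm] ut.
  have -> : step_fun b t u a 0 = fun=> 0.
    by apply/funext => x; rewrite /step_fun big_ord0.
  rewrite big_ord0; split; last by rewrite Rintegral_cst// mul0r.
  exact: integrable0.
have [i1 e1] := IHm (fun i im => ut i (ltnW im)).
have [i2 e2] := integral_step b (a m) (ut m (leqnn _)).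
have -> : step_fun b t u a m.+1 = fun x => step_fun b t u a m x +
    a m * \1_([set` Interval (BSide b (u m)) (BRight t)]) x.
  by apply/funext => x; rewrite /step_fun big_ord_recr.
rewrite big_ord_recr /=; split; first exact: (integrableD _ i1 i2).
by rewrite RintegralD// e1 e2.
Qed.

Context (f : R -> R) (t h : R) (m : nat).
Hypothesis f_nd : forall x y, 0 <= x -> x <= y -> f x <= f y.
Hypothesis f0 : f 0 = 0.
Hypothesis h_ge0 : 0 <= h.
Hypothesis hm : h * m%:R = t.

Lemma integrable_nondecreasing : mu.-integrable `[0, t] (EFin \o f).
Proof.
have t0 : 0 <= t by rewrite -hm mulr_ge0.
pose F x := f (Num.max 0 x).
have fF : {in `[0, t]%classic, EFin \o F =1 EFin \o f}.
  by move=> x; rewrite inE /= in_itv/= => /andP[x0 _]; rewrite /F max_r.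
apply: (@eq_integrable _ _ _ mu _ _ _ _ fF) => //.
apply: measurable_bounded_integrable => //.
- by rewrite /= lebesgue_measure_itv/=; case: ifP => _; rewrite ltry.
- apply: nondecreasing_measurable => // x y xy; apply: f_nd.
    by rewrite le_max lexx.
  by rewrite ge_max !le_max lexx xy /= orbT.
- exists (f t); split; first exact: num_real.
  move=> M tM x /=; rewrite in_itv/= => /andP[x0 xt].
  rewrite /F max_r// ger0_norm; last by rewrite -f0 f_nd.
  by apply: le_trans (ltW tM); exact: f_nd.
Qed.

(** Stopping the grid at x writes f x as a sum of increments that can be compared
term by term with a step function jumping at the grid points. *)
Lemma nondecreasing_telescope x : 0 <= x <= t ->
  f x = \sum_(i < m) (f (Num.min (h * i.+1%:R) x) - f (Num.min (h * i%:R) x)).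
Proof.
move=> /andP[x0 xt].
rewrite -(big_mkord xpredT
  (fun i => f (Num.min (h * i.+1%:R) x) - f (Num.min (h * i%:R) x))).
by rewrite telescope_sumr// hm mulr0 min_r// min_l// f0 subr0.
Qed.

Lemma grid_le i : (i <= m)%N -> 0 <= h * i%:R <= t.
Proof. by move=> im; rewrite mulr_ge0//= -hm ler_wpM2l// ler_nat. Qed.

Lemma grid_leS i : h * i%:R <= h * i.+1%:R.
Proof. by rewrite ler_wpM2l// ler_nat. Qed.

(** Each increment of f is moved to the right end of its interval; the sum is a
lower Riemann sum after summation by parts. *)
Lemma riemann_lower :
  \sum_(i < m) (f (h * i.+1%:R) - f (h * i%:R)) * (t - h * i.+1%:R) <=
  \int[mu]_(x in `[0, t]) f x.
Proof.
have [i1 <-] := integral_step_fun true (fun i => f (h * i.+1%:R) - f (h * i%:R))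
   (fun i im => grid_le im).
apply: le_Rintegral => //; first exact: integrable_nondecreasing.
move=> x /=; rewrite in_itv/= => xt; rewrite (nondecreasing_telescope xt).
case/andP: xt => x0 xt.
apply: ler_sum => i _; rewrite indicE; case: (boolP (_ \in _)).
  rewrite inE /= in_itv/= xt andbT => ix.
  by rewrite mulr1 !min_l// (le_trans (grid_leS i)).
move=> _; rewrite mulr0 subr_ge0; apply: f_nd.
  by rewrite le_min x0 mulr_ge0.
by rewrite le_min !ge_min lexx (grid_leS i) orbT.
Qed.

(** Here each increment is moved to the left end of its interval. *)
Lemma riemann_upper :
  \int[mu]_(x in `[0, t]) f x <=
  \sum_(i < m) (f (h * i.+1%:R) - f (h * i%:R)) * (t - h * i%:R).
Proof.
have [i1 <-] := integral_step_fun false (fun i => f (h * i.+1%:R) - f (h * i%:R))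
   (fun i im => grid_le (ltnW im)).
apply: le_Rintegral => //; first exact: integrable_nondecreasing.
move=> x /=; rewrite in_itv/= => xt; rewrite (nondecreasing_telescope xt).
case/andP: xt => x0 xt.
apply: ler_sum => i _; rewrite indicE; case: (boolP (_ \in _)).
  rewrite inE /= in_itv/= xt andbT => ix.
  rewrite mulr1 (min_l (ltW ix)) lerD2r; apply: f_nd.
    by rewrite le_min x0 mulr_ge0.
  by rewrite ge_min lexx.
rewrite notin_setE /= in_itv/= xt andbT => /negP; rewrite -leNgt => xi.
by rewrite mulr0 !min_r ?subrr// (le_trans xi (grid_leS i)).
Qed.

Lemma riemann_gap :
  \sum_(i < m) (f (h * i.+1%:R) - f (h * i%:R)) * (t - h * i%:R) =
  \sum_(i < m) (f (h * i.+1%:R) - f (h * i%:R)) * (t - h * i.+1%:R) + h * f t.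
Proof.
have -> : f t = \sum_(i < m) (f (h * i.+1%:R) - f (h * i%:R)).
  rewrite -(big_mkord xpredT (fun i => f (h * i.+1%:R) - f (h * i%:R))).
  by rewrite telescope_sumr// mulr0 hm f0 subr0.
rewrite mulr_sumr -big_split/=; apply: eq_bigr => i _.
by rewrite -natr1; ring.
Qed.

End riemann.

(** * Discretization of the jump density *)

(** The cell of (b, i) starts at h times this integer, where h (n + 1) = t. A jump
of the first process counted at the end of the i-th interval weighs
t - h (i + 1) = h (n - i), one of the second process counted at its start weighs
- (t - h i) = h (i - (n + 1)). *)
Definition cell_index n (p : bool * 'I_n.+1) : int :=
  if p.1 then n%:Z - p.2%:Z else p.2%:Z - n.+1%:Z.

Lemma cell_index_inj n : injective (@cell_index n).
Proof.
move=> [b i] [b' j]; rewrite /cell_index /=.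
have := ltn_ord i; have := ltn_ord j; case: b; case: b' => jn im e;
  try (by congr pair; apply: val_inj; move: e => /=; lia); lia.
Qed.

(** End points do not contribute to the integral, and the jump density jumps only
at end points of cells. *)
Lemma integral_const_itv (R : realType) (f : R -> R) (c x y : R) :
  x <= y -> (forall z, x < z < y -> f z = c) ->
  (\int[lebesgue_measure]_(z in `[x, y[) (f z)%:E = (c * (y - x))%:E)%E.
Proof.
move=> xy fc.
rewrite integral_itv_bndoo; last first.
  apply: (eq_measurable_fun (cst c%:E)) => // z.
  by rewrite inE /= in_itv/= => /fc ->.
rewrite (eq_integral (cst c%:E)); last first.
  by move=> z; rewrite inE /= in_itv/= => /fc ->.
rewrite integral_cst//= lebesgue_measure_itv/= lte_fin.
have [_|yx] := ltP x y; first by rewrite EFinM.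
by rewrite (@le_anti _ _ x y) ?xy ?yx// subrr mulr0 mule0.
Qed.

Section cells.
Context (R : realType) (t : R) (n : nat).
Hypothesis t_gt0 : 0 < t.

Let h : R := t / n.+1%:R.

Lemma mesh_gt0 : 0 < h.
Proof. by rewrite /h divr_gt0. Qed.

Lemma meshM : h * n.+1%:R = t.
Proof. by rewrite /h divfK. Qed.

Definition cell (p : bool * 'I_n.+1) : set R :=
  `[h * (cell_index p)%:~R, h * (cell_index p + 1)%:~R[%classic.

Definition round_down (z : R) : R := h * (Num.floor (z / h))%:~R.

Lemma cell_floor p z : cell p z -> Num.floor (z / h) = cell_index p.
Proof.
rewrite /cell /= in_itv/= => /andP[lz zl]; apply: floor_def.
by rewrite ler_pdivlMr ?ltr_pdivrMr ?mesh_gt0// mulrC lz mulrC.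
Qed.

Lemma trivIset_cell : trivIset setT cell.
Proof.
move=> p q _ _ [z [/cell_floor zp /cell_floor zq]].
by apply: cell_index_inj; rewrite -zp -zq.
Qed.

Lemma round_down_le z : round_down z <= z <= round_down z + h.
Proof.
rewrite /round_down -[X in _ + X]mulr1 -mulrDr mulrC -ler_pdivlMr ?mesh_gt0//.
have /andP[-> /ltW zf] := floor_itv (z / h).
by rewrite mulrC -ler_pdivrMr ?mesh_gt0// -intrD1.
Qed.

Lemma measurable_round_down : measurable_fun setT round_down.
Proof.
apply: nondecreasing_measurable => // x y xy.
rewrite /round_down ler_pM2l ?mesh_gt0// ler_int le_floor//.
by rewrite ler_pM2r// invr_gt0 mesh_gt0.
Qed.

Context (lambda beta : R).
Hypotheses (lambda_gt0 : 0 < lambda) (beta_gt0 : 0 < beta).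

Definition cell_prob (p : bool * 'I_n.+1) : R :=
  (if p.1 then lambda else beta) / (lambda + beta) / n.+1%:R.

Lemma cell_integral p :
  (\int[lebesgue_measure]_(z in cell p) (jump_density lambda beta t z)%:E =
   (cell_prob p)%:E)%E.
Proof.
have h0 := mesh_gt0; have n0 : (n.+1%:R : R) != 0 by [].
have lb0 : lambda + beta != 0 by rewrite gt_eqF// addr_gt0.
rewrite /cell (integral_const_itv
  (c := (if p.1 then lambda else beta) / (t * (lambda + beta)))).
- congr EFin; rewrite -mulrBr -intrB addrAC subrr add0r mulr1 /cell_prob /h.
  by field; rewrite nat1r n0 lb0 gt_eqF.
- by rewrite ler_pM2l// ler_int lerDl.
- case: p => -[] i z; rewrite /cell_index /jump_density /=; have := ltn_ord i.
    move=> im /andP[lz zl].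
    have z0 : 0 < z by apply: le_lt_trans lz; rewrite mulr_ge0 ?(ltW h0)// ler0z; lia.
    have zt : z < t.
      apply: (lt_le_trans zl); rewrite -[leRHS]meshM ler_pM2l// -[leRHS]/((n.+1%:Z)%:~R).
      by rewrite ler_int; lia.
    by rewrite [z <= 0]leNgt z0 andbF zt.
  move=> im /andP[lz zl].
  have z0 : z <= 0.
    apply: (le_trans (ltW zl)); rewrite pmulr_rle0// lerz0; lia.
  have zt : - t < z.
    apply: le_lt_trans lz; rewrite -[in leLHS]meshM -mulrN ler_pM2l//.
    by rewrite -[n.+1%:R]/((n.+1%:Z)%:~R) -intrN ler_int; lia.
  by rewrite z0 zt.
Qed.

Lemma cell_prob_gt0 p : 0 < cell_prob p.
Proof.
by rewrite /cell_prob !divr_gt0 ?addr_gt0//; case: p.1.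
Qed.

Lemma sum_cell_prob : \sum_p cell_prob p = 1.
Proof.
have lb0 : lambda + beta != 0 by rewrite gt_eqF// addr_gt0.
rewrite -(pair_bigA _ (fun b (i : 'I_n.+1) =>
  (if b then lambda else beta) / (lambda + beta) / n.+1%:R)) /=.
rewrite big_bool /= !sumr_const !card_ord -mulrnDl -[LHS]mulr_natr.
by field; rewrite lb0 nat1r pnatr_eq0.
Qed.

(** The thinned rate of a cell is the parameter of the corresponding increment over
a time interval of length h. *)
Lemma cell_rate p : (lambda + beta) * t * cell_prob p =
  (if p.1 then lambda else beta) * h.
Proof.
have lb0 : lambda + beta != 0 by rewrite gt_eqF// addr_gt0.
rewrite /cell_prob /h; field.
by rewrite lb0 nat1r pnatr_eq0.
Qed.

End cells.

(** * The two discretized variables *)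

Section discretization.
Context (R : realType) (lambda beta t : R).
Hypotheses (lambda_gt0 : 0 < lambda) (beta_gt0 : 0 < beta) (t_gt0 : 0 < t).
Local Notation mu := (@lebesgue_measure R).

Section paths.
Context (d : measure_display) (T : measurableType d) (P : probability T R).
Context (rate : R) (N : R -> T -> nat).
Hypothesis NP : poisson_process P rate N.

Lemma poisson_path_nondecreasing w x y : 0 <= x -> x <= y ->
  ((N x w)%:R : R) <= (N y w)%:R.
Proof. by move=> x0 xy; rewrite ler_nat; exact: (poisson_nondecreasing NP). Qed.

Lemma poisson_path_start w : ((N 0 w)%:R : R) = 0.
Proof. by rewrite (poisson_start NP). Qed.

Lemma integrable_poisson_path w :
  mu.-integrable `[0, t] (EFin \o (fun s => (N s w)%:R : R)).
Proof.
apply: (@integrable_nondecreasing R (fun s => (N s w)%:R) t t 1) => //.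
- by move=> x y; exact: poisson_path_nondecreasing.
- exact: poisson_path_start.
- exact: ltW.
- by rewrite mulr1.
Qed.

Lemma natr_increment h i w : 0 < h ->
  ((increment N h i w)%:R : R) = (N (h * i.+1%:R) w)%:R - (N (h * i%:R) w)%:R.
Proof.
move=> h0; rewrite natrB//; apply: (poisson_nondecreasing NP).
  exact: grid_ge0.
by rewrite ler_pM2l// ler_nat.
Qed.

Lemma poisson_law k :
  P (N t @^-1` [set k]) = (poisson_pmf (rate * t) k)%:E.
Proof.
rewrite -[X in rate * X]subr0 -(poisson_increment_law NP)//.
by congr (P _); apply/seteqP; split=> w /=; rewrite (poisson_start NP) subn0.
Qed.

End paths.

Definition cell_weight n (v : {ffun bool * 'I_n.+1 -> nat}) : R :=
  \sum_p (t / n.+1%:R * (cell_index p)%:~R) *+ v p.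

Section integral.
Context (d : measure_display) (T : measurableType d) (P : probability T R).
Context (Nl Nb : R -> T -> nat).
Hypothesis Nl_poisson : poisson_process P lambda Nl.
Hypothesis Nb_poisson : poisson_process P beta Nb.

Lemma integral_sub_poisson w :
  \int[mu]_(s in `[0, t]) ((Nl s w)%:R - (Nb s w)%:R : R) =
  \int[mu]_(s in `[0, t]) ((Nl s w)%:R : R) -
  \int[mu]_(s in `[0, t]) ((Nb s w)%:R : R).
Proof.
rewrite RintegralB//; apply: integrable_poisson_path.
- exact: Nl_poisson.
- exact: Nb_poisson.
Qed.

Lemma cell_weight_jump_counts n w (h := t / n.+1%:R) :
  cell_weight (jump_counts Nl Nb h n w) =
  \sum_(i < n.+1) ((Nl (h * i.+1%:R) w)%:R - (Nl (h * i%:R) w)%:R) * (t - h * i.+1%:R) -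
  \sum_(i < n.+1) ((Nb (h * i.+1%:R) w)%:R - (Nb (h * i%:R) w)%:R) * (t - h * i%:R).
Proof.
have h0 : 0 < h by exact: mesh_gt0.
have tE : t = h * n.+1%:R by rewrite (meshM t n).
rewrite /cell_weight -/h.
under eq_bigr do rewrite -mulr_natl ffunE.
rewrite -(pair_bigA _ (fun b (i : 'I_n.+1) =>
  (increment (if b then Nl else Nb) h i w)%:R * (h * (cell_index (b, i))%:~R))) /=.
rewrite big_bool /= -sumrN; congr (_ + _); apply: eq_bigr => i _;
  rewrite /cell_index /= intrB -?pmulrn.
  by rewrite (natr_increment Nl_poisson)// tE; ring.
by rewrite (natr_increment Nb_poisson)// tE; ring.
Qed.

(** A lower sum for the first process minus an upper sum for the second one lies
below the integral; by [riemann_gap] each of them is off by at most h times the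
number of jumps. *)
Lemma integral_discretization n w :
  cell_weight (jump_counts Nl Nb (t / n.+1%:R) n w) <=
  \int[mu]_(s in `[0, t]) ((Nl s w)%:R - (Nb s w)%:R : R) <=
  cell_weight (jump_counts Nl Nb (t / n.+1%:R) n w) +
    t * ((Nl t w)%:R + (Nb t w)%:R) / n.+1%:R.
Proof.
rewrite integral_sub_poisson cell_weight_jump_counts.
have h0 := ltW (mesh_gt0 n t_gt0); have hm := meshM t n.
set h := t / _ in h0 hm *.
have ndl := poisson_path_nondecreasing Nl_poisson w.
have ndb := poisson_path_nondecreasing Nb_poisson w.
have l0 := poisson_path_start Nl_poisson w.
have b0 := poisson_path_start Nb_poisson w.
have := riemann_lower ndl l0 h0 hm; have := riemann_upper ndl l0 h0 hm.
have := riemann_lower ndb b0 h0 hm; have := riemann_upper ndb b0 h0 hm.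
have := riemann_gap (f := fun s => (Nl s w)%:R) l0 hm.
have := riemann_gap (f := fun s => (Nb s w)%:R) b0 hm.
have -> : t * ((Nl t w)%:R + (Nb t w)%:R) / n.+1%:R = h * (Nl t w)%:R + h * (Nb t w)%:R.
  by rewrite /h; ring.
move: (\int[mu]_(s in `[0, t]) ((Nl s w)%:R : R))
  (\int[mu]_(s in `[0, t]) ((Nb s w)%:R : R)).
(* The four Riemann sums become atoms of a linear arithmetic problem. *)
move: (\sum_(i < n.+1) _ * _) (\sum_(i < n.+1) _ * _)
  (\sum_(i < n.+1) _ * _) (\sum_(i < n.+1) _ * _).
move=> a b c e x y -> ->; lra.
Qed.

End integral.

Section random_sum.
Context (d : measure_display) (T : measurableType d) (P : probability T R).
Context (N : R -> T -> nat) (Z : nat -> {RV P >-> R}).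

(** Rounding down loses at most h in each of the [N t w] terms. *)
Lemma random_sum_discretization n w :
  \sum_(j < N t w) round_down t n (Z j w) <= \sum_(j < N t w) Z j w <=
  \sum_(j < N t w) round_down t n (Z j w) + t * (N t w)%:R / n.+1%:R.
Proof.
apply/andP; split.
  by apply: ler_sum => j _; have /andP[] := round_down_le n t_gt0 (Z j w).
have -> : t * (N t w)%:R / n.+1%:R = \sum_(j < N t w) t / n.+1%:R.
  by rewrite sumr_const card_ord -[RHS]mulr_natr mulrAC.
rewrite -big_split/=.
by apply: ler_sum => j _; have /andP[] := round_down_le n t_gt0 (Z j w).
Qed.

End random_sum.

(** Both variables are the function [cell_weight] of the numbers of jumps in the
cells, and these numbers have the same joint law on both sides. *)
Lemma eq_in_distribution_discretization
    (d : measure_display) (T : measurableType d) (P : probability T R)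
    (Nl Nb : R -> T -> nat)
    (d' : measure_display) (T' : measurableType d') (P' : probability T' R)
    (Nt : R -> T' -> nat) (Z : nat -> {RV P' >-> R}) n :
  poisson_process P lambda Nl -> poisson_process P beta Nb ->
  independent_processes P Nl Nb ->
  poisson_process P' (lambda + beta) Nt ->
  (forall j, has_density (Z j) (jump_density lambda beta t)) ->
  mutually_independent P' (fun j w => Z j w) ->
  independent_systems P' (sigma_family setT (fun j w => Z j w))
    (g_sigma_algebra_preimage (Nt t)) ->
  eq_in_distribution P P'
    (fun w => cell_weight (jump_counts Nl Nb (t / n.+1%:R) n w))
    (fun w => \sum_(j < Nt t w) round_down t n (Z j w)).
Proof.
move=> lP bP lb_indep tP Z_density Z_indep ZN_indep.
have h_gt0 := mesh_gt0 n t_gt0.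
have mN : measurable_fun setT (Nt t) by apply: (poisson_measurable tP); exact: ltW.
have mcell (p : bool * 'I_n.+1) : measurable (cell t p : set R) by exact: measurable_itv.
have Zcell j (p : bool * 'I_n.+1) :
    P' (Z j @^-1` cell t p) = (cell_prob lambda beta p)%:E.
  by rewrite -(cell_integral t_gt0 lambda_gt0 beta_gt0) -(Z_density j).
have tc := trivIset_cell (n := n) t_gt0.
have cp := @cell_prob_gt0 R n _ _ lambda_gt0 beta_gt0.
have cs := sum_cell_prob n lambda_gt0 beta_gt0.
have Lt : 0 < (lambda + beta) * t by rewrite mulr_gt0// addr_gt0.
pose i0 : bool * 'I_n.+1 := (true, ord0).
apply: (@eq_in_distribution_atoms _ _ _ _ _ _ _ _ _
  (thinned_event (Nt t) Z i0 (@cell R t n)) (@cell_weight n)) => //.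
- by move=> v; exact: (measurable_preimage_jump_counts lP bP).
- by move=> v; exact: measurable_thinned_event.
- exact: trivIset_thinned_event.
- move=> v; rewrite (probability_jump_counts lP bP)//.
  rewrite (probability_thinned_event Z_indep ZN_indep i0 mcell tc Zcell
    (poisson_law tP) Lt cp cs).
  by congr EFin; apply: eq_bigr => p _; rewrite -cell_rate.
- move=> v w vw; apply: (thinned_event_sum
    (x := fun p => t / n.+1%:R * (cell_index p)%:~R) _ vw).
  by move=> p z /cell_floor; rewrite /round_down => ->.
- apply: (measurable_random_sum (Z := fun j w => round_down t n (Z j w))) => // j.
  by apply: measurableT_comp => //; exact: measurable_round_down.
Qed.

End discretization.

(** * The theorem *)

Theorem theorem4p4 (R : realType) (lambda beta : R)
    (d : measure_display) (T : measurableType d) (P : probability T R)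
    (Nl Nb : R -> T -> nat)
    (d' : measure_display) (T' : measurableType d') (P' : probability T' R)
    (Nt : R -> T' -> nat) (Z : nat -> {RV P' >-> R}) (t : R)
    (lambda_gt0 : 0 < lambda) (beta_gt0 : 0 < beta) (t_gt0 : 0 < t)
    (Nl_poisson : poisson_process P lambda Nl)
    (Nb_poisson : poisson_process P beta Nb)
    (Nl_Nb_independent : independent_processes P Nl Nb)
    (Nt_poisson : poisson_process P' (lambda + beta) Nt)
    (Z_density : forall j, has_density (Z j) (jump_density lambda beta t))
    (Z_independent : mutually_independent P' (fun j w => Z j w))
    (Z_Nt_independent : independent_systems P'
       (sigma_family setT (fun j w => Z j w))
       (g_sigma_algebra_preimage (Nt t))) :
  let Nring : R -> T -> R := fun s w => (Nl s w)%:R - (Nb s w)%:R in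
  (forall w, \int[lebesgue_measure]_(s in `[0, t]) Nring s w =
     \int[lebesgue_measure]_(s in `[0, t]) ((Nl s w)%:R : R) -
     \int[lebesgue_measure]_(s in `[0, t]) ((Nb s w)%:R : R)) /\
  eq_in_distribution P P'
    (fun w => \int[lebesgue_measure]_(s in `[0, t]) Nring s w)
    (fun w => \sum_(j < Nt t w) Z j w).
Proof.
move=> Nring; split.
  by move=> w; exact: (integral_sub_poisson t_gt0 Nl_poisson Nb_poisson).
apply: (eq_in_distribution_lim
  (fun n => integral_discretization t_gt0 Nl_poisson Nb_poisson n)
  (fun n => random_sum_discretization t_gt0 Nt Z n)).
by move=> n; apply: (eq_in_distribution_discretization lambda_gt0 beta_gt0 t_gt0).
Qed.
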